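(* Let $A\in\mathbb{R}^{n\times n}$ be symmetric positive definite, let $S\in\mathbb{R}^{n\times n_{\rm s}}$ ($n_{\rm s}\leq n$) and $P\in\mathbb{R}^{n\times n_{\rm c}}$ ($n_{\rm c}<n$) be of full column rank with $\operatorname{rank}(S\ \, P)=n$ (and $S=I_n$ if $n_{\rm s}=n$), put $A_{\rm s}=S^{T}AS$, and let $M_{\rm s}\in\mathbb{R}^{n_{\rm s}\times n_{\rm s}}$ be a nonsingular matrix such that $M_{\rm s}+M_{\rm s}^{T}-A_{\rm s}$ is positive definite. Let $\widetilde{M}_{\rm s}=M_{\rm s}^{T}\big(M_{\rm s}+M_{\rm s}^{T}-A_{\rm s}\big)^{-1}M_{\rm s}$, $\Pi_{A}=P(P^{T}AP)^{-1}P^{T}A$, and $$E_{\rm TL}=\big(I-SM_{\rm s}^{-T}S^{T}A\big)(I-\Pi_{A})\big(I-SM_{\rm s}^{-1}S^{T}A\big).$$ Let $\{(\mu_{i},\mathbf{v}_{i})\}_{i=1}^{n}$ be the eigenpairs of $S\widetilde{M}_{\rm s}^{-1}S^{T}A$, namely $S\widetilde{M}_{\rm s}^{-1}S^{T}A\mathbf{v}_{i}=\mu_{i}\mathbf{v}_{i}$, where $$0\leq\mu_{1}\leq\mu_{2}\leq\cdots\leq\mu_{n}\leq 1\quad\text{and}\quad \mathbf{v}_{i}^{T}A\mathbf{v}_{j}=\begin{cases}1&\text{if } i=j,\\ 0&\text{if } i\neq j.\end{cases}$$ Then $$\|E_{\rm TL}\|_{A}\geq 1-\mu_{n_{\rm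 c}+1},$$ and the equality holds if $\mathcal{R}(P)=\operatorname{span}\{\mathbf{v}_{1},\ldots,\mathbf{v}_{n_{\rm c}}\}$.
   Context: $(S\ \, P)$ denotes the matrix formed by the columns of $S$ followed by those of $P$; $\mathcal{R}(\cdot)$ denotes the column space. For the symmetric positive definite matrix $A$, $\|\mathbf{v}\|_{A}=\sqrt{\mathbf{v}^{T}A\mathbf{v}}$ for $\mathbf{v}\in\mathbb{R}^{n}$, and $\|B\|_{A}=\max_{\mathbf{v}\neq 0}\|B\mathbf{v}\|_{A}/\|\mathbf{v}\|_{A}$ for $B\in\mathbb{R}^{n\times n}$. $E_{\rm TL}$ is the iteration matrix, and $\|E_{\rm TL}\|_A$ the convergence factor, of the two-level method with smoother data $(S,M_{\rm s})$ and prolongation $P$. *)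

(* Defs.v *)
From mathcomp Require Import all_boot all_order all_algebra.
From mathcomp Require Import all_classical all_reals all_analysis.
Import Order.TTheory GRing.Theory Num.Theory.
Import numFieldNormedType.Exports.

Set Implicit Arguments.
Unset Strict Implicit.
Unset Printing Implicit Defensive.

Local Open Scope classical_set_scope.
Local Open Scope ring_scope.

(* Positive definiteness does not include symmetry. *)
Definition posdef (R : realType) n (B : 'M[R]_n) : Prop :=
  forall v : 'cV[R]_n, v != 0 -> 0 < (v^T *m B *m v) 0 0.

Definition spd (R : realType) n (B : 'M[R]_n) : Prop :=
  B^T = B /\ posdef B.

Definition colspace (R : realType) m n (B : 'M[R]_(m, n)) : {vspace 'cV[R]_m} :=
  <<[seq col j B | j : 'I_n]>>%VS.

Definition Anorm (R : realType) n (A : 'M[R]_n) (v : 'cV[R]_n) : R :=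
  Num.sqrt ((v^T *m A *m v) 0 0).

(* The supremum is a maximum when [A] is positive definite and [0 < n], see
   [Aopnorm_max]. *)
Definition Aopnorm (R : realType) n (A B : 'M[R]_n) : R :=
  sup [set Anorm A (B *m v) / Anorm A v | v in [set v : 'cV[R]_n | v != 0]].

Definition smoother_tilde (R : realType) n ns (A : 'M[R]_n) (S : 'M[R]_(n, ns))
    (M : 'M[R]_ns) : 'M[R]_ns :=
  M^T *m invmx (M + M^T - S^T *m A *m S) *m M.

Definition PiA (R : realType) n nc (A : 'M[R]_n) (P : 'M[R]_(n, nc)) : 'M[R]_n :=
  P *m invmx (P^T *m A *m P) *m P^T *m A.

Definition ETL (R : realType) n ns nc (A : 'M[R]_n) (S : 'M[R]_(n, ns))
    (M : 'M[R]_ns) (P : 'M[R]_(n, nc)) : 'M[R]_n :=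
  (1%:M - S *m invmx M^T *m S^T *m A) *m (1%:M - PiA A P)
    *m (1%:M - S *m invmx M *m S^T *m A).

Lemma Anorm_gt0 (R : realType) n (A : 'M[R]_n) (v : 'cV[R]_n) :
  posdef A -> v != 0 -> 0 < Anorm A v.
Proof. by move=> pA v0; rewrite /Anorm sqrtr_gt0 pA. Qed.

Lemma AnormZ (R : realType) n (A : 'M[R]_n) (a : R) (v : 'cV[R]_n) :
  Anorm A (a *: v) = `|a| * Anorm A v.
Proof.
rewrite /Anorm; have -> : (a *: v)^T = a *: v^T by apply/matrixP => i j; rewrite !mxE.
rewrite -!scalemxAl -scalemxAr scalerA mxE -expr2.
by rewrite sqrtrM ?sqr_ge0// sqrtr_sqr.
Qed.

Lemma Anorm_continuous (R : realType) n (A B : 'M[R]_n) :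
  continuous (fun x : 'rV[R]_n => Anorm A (B *m x^T)).
Proof.
move=> x; apply: (@continuous_comp _ _ _
  (fun y : 'rV[R]_n => ((B *m y^T)^T *m A *m (B *m y^T)) 0 0) Num.sqrt); last first.
  exact: sqrt_continuous.
have -> : (fun y : 'rV[R]_n => ((B *m y^T)^T *m A *m (B *m y^T)) 0 0) =
   (fun y => \sum_i \sum_j (B^T *m A *m B) i j * (y 0 i * y 0 j)).
  apply/funext => y; rewrite trmx_mul trmxK !mulmxA -(mulmxA y) -(mulmxA y).
  move: (B^T *m A *m B) => C; rewrite !mxE exchange_big /=.
  apply: eq_bigr => j _; rewrite !mxE big_distrl /=; apply: eq_bigr => i _.
  by rewrite (mulrC (y 0 i)) mulrA.
move: x; apply: continuous_big => [|i _]; first exact: add_continuous.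
apply: continuous_big => [|j _ x]; first exact: add_continuous.
apply: (@continuousM _ _ (fun=> (B^T *m A *m B) i j)
  (fun y : 'rV[R]_n => y 0 i * y 0 j)); first exact: cst_continuous.
apply: (@continuousM _ _ (fun y : 'rV[R]_n => y 0 i) (fun y => y 0 j));
  exact: coord_continuous.
Qed.

Lemma Aopnorm_max (R : realType) n (A B : 'M[R]_n) : (0 < n)%N -> posdef A ->
  (exists2 v : 'cV[R]_n, v != 0 & Aopnorm A B = Anorm A (B *m v) / Anorm A v) /\
  (forall v : 'cV[R]_n, v != 0 -> Anorm A (B *m v) / Anorm A v <= Aopnorm A B).
Proof.
case: n A B => // n A B _ pA.
set f := fun v : 'cV[R]_n.+1 => Anorm A (B *m v) / Anorm A v.
suff [c c0 cmax] : exists2 c, c != 0 & forall v, v != 0 -> f v <= f c.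
  have -> : Aopnorm A B = f c.
    apply/eqP; rewrite eq_le; apply/andP; split.
      by apply: ge_sup; [exists (f c); exists c | move=> _ [v v0 <-]; exact: cmax].
    apply: ub_le_sup; last by exists c.
    by exists (f c) => _ [v v0 <-]; exact: cmax.
  by split => //; exists c.
pose K := [set x : 'rV[R]_n.+1 | `|x| = 1].
have K0 : K !=set0.
  have u0 : (const_mx 1 : 'rV[R]_n.+1) != 0.
    by apply/eqP => /matrixP/(_ 0 0); rewrite !mxE => /eqP; rewrite oner_eq0.
  exists (`|const_mx 1 : 'rV[R]_n.+1|^-1 *: const_mx 1).
  by rewrite /K /= normrZ normfV normr_id mulVf// normr_eq0.
have cK : compact K.
  apply: bounded_closed_compact.
    by exists 1; split => // r r1 x /= ->; exact: ltW.
  have -> : K = Num.norm @^-1` [set 1 : R] by [].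
  apply: preimage_closed => [x _|]; [exact: norm_continuous | exact: closed_eq].
have fK : {within K, continuous (fun x : 'rV[R]_n.+1 => f x^T)}.
  apply: continuous_in_subspaceT => x; rewrite inE /K /= => x1.
  apply: (@continuousM _ _ (fun x : 'rV[R]_n.+1 => Anorm A (B *m x^T))
    (fun x => (Anorm A x^T)^-1)); first exact: Anorm_continuous.
  apply: (@continuousV _ _ (fun x : 'rV[R]_n.+1 => Anorm A x^T)).
    rewrite gt_eqF// Anorm_gt0//; apply: contra_eq_neq x1.
    move=> /(congr1 trmx); rewrite trmxK trmx0 => ->.
    by rewrite normr0 eq_sym oner_eq0.
  have := @Anorm_continuous R n.+1 A 1%:M x.
  by under eq_fun do rewrite mul1mx.
have [c cK1 cmax] := EVT_max_rV K0 cK fK.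
exists c^T.
  apply/eqP => /(congr1 trmx); rewrite trmxK trmx0 => c0.
  move: cK1; rewrite inE /K /= c0 normr0 => /esym/eqP; by rewrite oner_eq0.
move=> v v0; have v1 : `|v^T| != 0.
  rewrite normr_eq0; apply: contra_neq v0 => /(congr1 trmx).
  by rewrite trmxK trmx0.
have := cmax (`|v^T|^-1 *: v^T); rewrite inE /K /=.
rewrite normrZ normfV normr_id mulVf// => /(_ erefl); apply: le_trans.
have -> : (`|v^T|^-1 *: v^T)^T = `|v^T|^-1 *: v.
  by apply/matrixP => i j; rewrite !mxE.
rewrite /f -scalemxAr !AnormZ -mulf_div divff ?mul1r//.
by rewrite normr_eq0 invr_eq0.
Qed.

(* Main.v *)
Require Import Defs.
From mathcomp Require Import all_boot all_order all_algebra.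
From mathcomp Require Import all_classical all_reals all_analysis.
From mathcomp Require Import ring.
Import Order.TTheory GRing.Theory Num.Theory.

Set Implicit Arguments.
Unset Strict Implicit.
Unset Printing Implicit Defensive.

Local Open Scope ring_scope.

(** Write [G = I - S Ms^-1 S^T A], [G' = I - S Ms^-T S^T A] for its
    [A]-adjoint, [Q = I - PiA] for the [A]-orthogonal projection onto the
    [A]-orthogonal complement of R(P), and [K] for the matrix whose eigenpairs
    are given.  As [Q] is idempotent and [A]-selfadjoint, the iteration matrix is
    [E = G' Q G = N' N] where [N = Q G] and [N' = G' Q] are [A]-adjoint to each
    other.  A direct computation ([symmetrized_smoother]) gives [G G' = I - K],
    so [|N' w|^2 = <Q w, (I - K) Q w>] in the [A]-inner product.  This is a
    diagonal quadratic form, with weights [1 - mu i], in the [A]-orthonormal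
    eigenbasis.

    The norm of [N' N] is controlled by the quadratic form [|N' w|^2]: it is at
    least [t] once [|N' w|^2 >= t |w|^2] for one nonzero [w]
    ([le_Aopnorm_adjoint]), and at most [t] if [|N' w|^2 <= t |w|^2] for all [w]
    ([Aopnorm_adjoint_le]).

    For the lower bound, the first [nc + 1] eigenvectors span a space of
    dimension larger than the number [nc] of equations [P^T A w = 0], so it
    contains a nonzero [w] fixed by [Q]; on it every weight is at least
    [1 - mu_(nc+1)].  For the equality case, if R(P) is spanned by the first
    [nc] eigenvectors then [Q w] only involves the remaining ones, on which
    every weight is at most [1 - mu_(nc+1)]. *)

(** * The inner product of a symmetric positive definite matrix *)

Definition adot (R : realType) n (A : 'M[R]_n) (u w : 'cV[R]_n) : R :=
  (u^T *m A *m w) 0 0.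

Section InnerProduct.
Variables (R : realType) (n : nat) (A : 'M[R]_n).
Implicit Types (B C N : 'M[R]_n) (u w x y : 'cV[R]_n).

Lemma adotDl u w x : adot A (u + w) x = adot A u x + adot A w x.
Proof. by rewrite /adot linearD /= !mulmxDl mxE. Qed.

Lemma adotDr u w x : adot A x (u + w) = adot A x u + adot A x w.
Proof. by rewrite /adot mulmxDr mxE. Qed.

Lemma adotZl a u w : adot A (a *: u) w = a * adot A u w.
Proof. by rewrite /adot linearZ /= -!scalemxAl mxE. Qed.

Lemma adotZr a u w : adot A u (a *: w) = a * adot A u w.
Proof. by rewrite /adot -scalemxAr mxE. Qed.

(** The matrix equation in the hypothesis is the way [A]-adjointness of [B] and
    [C] is expressed throughout. *)
Lemma adot_adjoint B C u w :
  B^T *m A = A *m C -> adot A (B *m u) w = adot A u (C *m w).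
Proof. by move=> BC; rewrite /adot trmx_mul -[u^T *m _ *m A]mulmxA BC !mulmxA. Qed.

Hypothesis Aspd : spd A.

Lemma adotC u w : adot A u w = adot A w u.
Proof.
have -> : adot A u w = ((u^T *m A *m w)^T) 0 0 by rewrite mxE.
by rewrite !trmx_mul trmxK Aspd.1 mulmxA.
Qed.

Lemma adot_gt0 u : u != 0 -> 0 < adot A u u.
Proof. exact: Aspd.2. Qed.

Lemma adot_ge0 u : 0 <= adot A u u.
Proof.
have [->|/adot_gt0/ltW//] := eqVneq u 0.
by rewrite /adot mulmx0 mxE.
Qed.

Lemma adot_CauchySchwarz u w : adot A u w ^+ 2 <= adot A u u * adot A w w.
Proof.
have [->|w0] := eqVneq w 0; first by rewrite /adot !mulmx0 !mxE expr0n mulr0.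
have ww := adot_gt0 w0.
(* Up to scaling, this vector is the component of [u] orthogonal to [w]. *)
have := adot_ge0 (adot A w w *: u + (- adot A u w) *: w).
rewrite !(adotDl, adotDr, adotZl, adotZr) (adotC w u) => h.
rewrite -subr_ge0 -(pmulr_rge0 _ ww); move: h; congr (0 <= _); ring.
Qed.

Lemma Anorm_sqr u : Anorm A u ^+ 2 = adot A u u.
Proof. by rewrite sqr_sqrtr // adot_ge0. Qed.

(** With [x = N' w], Cauchy-Schwarz gives [|x|^2 = <N x, w> <= |N x| |w|], hence
    [|N x|^2 >= t |x|^2]; since [|N x|^2 = <x, N' N x>], Cauchy-Schwarz once
    more gives [|N' N x| >= t |x|]. *)
Lemma le_Aopnorm_adjoint N N' w t : N'^T *m A = A *m N -> 0 <= t -> w != 0 ->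
  t * adot A w w <= adot A (N' *m w) (N' *m w) -> t <= Aopnorm A (N' *m N).
Proof.
move=> adj t0 w0 hw.
have n_gt0 : (0 < n)%N.
  rewrite lt0n; apply: contra_neqN w0 => /eqP n0.
  by apply/matrixP => i; have := ltn_ord i; rewrite {2}n0.
have [_ ub] := Aopnorm_max (N' *m N) n_gt0 Aspd.2.
(* [N' w] may vanish when [t = 0], but norms are nonnegative. *)
have [->|tn0] := eqVneq t 0.
  by apply: le_trans (ub w w0); rewrite divr_ge0 // sqrtr_ge0.
have tp : 0 < t by rewrite lt_def tn0.
set x := N' *m w in hw.
have ww := adot_gt0 w0.
have xx : 0 < adot A x x by apply: lt_le_trans hw; exact: mulr_gt0.
have x0 : x != 0.
  by apply: contraTneq xx => ->; rewrite /adot mulmx0 mxE ltxx.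
apply: le_trans (ub x x0).
rewrite ler_pdivlMr ?(Anorm_gt0 Aspd.2) // -ler_sqr ?nnegrE ?sqrtr_ge0 //;
  last by rewrite mulr_ge0 // sqrtr_ge0.
rewrite exprMn !Anorm_sqr -mulmxA.
have e1 : adot A w (N *m x) = adot A x x by rewrite -(adot_adjoint _ _ adj).
have e2 : adot A (N' *m (N *m x)) x = adot A (N *m x) (N *m x).
  exact: adot_adjoint.
have := adot_CauchySchwarz w (N *m x); rewrite e1.
have := adot_CauchySchwarz (N' *m (N *m x)) x; rewrite e2.
move: (adot A (N' *m _) _) (adot A (N *m x) _) (adot A x x) (adot A w w)
  (adot_ge0 (N *m x)) hw xx ww => e b a c b0 hw xx ww h1 h2.
have h3 : t * a <= b.
  rewrite -(ler_pM2l ww); apply: le_trans h2; rewrite mulrA (mulrC c) expr2.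
  by rewrite ler_pM2r.
rewrite -(ler_pM2r xx); apply: le_trans h1.
have -> : t ^+ 2 * a * a = (t * a) ^+ 2 by ring.
by rewrite ler_sqr ?nnegrE // mulr_ge0 // ltW.
Qed.

(** [|N' N x|^2 <= t |N x|^2], and [|N x|^2 = <x, N' N x> <= |x| |N' N x|] turns
    this into [|N x|^2 <= t |x|^2]. *)
Lemma Aopnorm_adjoint_le N N' t : (0 < n)%N -> N'^T *m A = A *m N -> 0 <= t ->
  (forall y, adot A (N' *m y) (N' *m y) <= t * adot A y y) ->
  Aopnorm A (N' *m N) <= t.
Proof.
move=> n_gt0 adj t0 hN.
have [[x x0 ->] _] := Aopnorm_max (N' *m N) n_gt0 Aspd.2.
rewrite ler_pdivrMr ?(Anorm_gt0 Aspd.2) // -ler_sqr ?nnegrE ?sqrtr_ge0 //;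
  last by rewrite mulr_ge0 // sqrtr_ge0.
rewrite exprMn !Anorm_sqr -mulmxA.
have e2 : adot A (N' *m (N *m x)) x = adot A (N *m x) (N *m x).
  exact: adot_adjoint.
have := adot_CauchySchwarz (N' *m (N *m x)) x; rewrite e2.
move: (hN (N *m x)) (adot_ge0 (N *m x)) (adot_gt0 x0).
move: (adot A (N' *m _) _) (adot A (N *m x) _) (adot A x x).
move=> e b a eb b0 a0 h.
suff hb : b <= t * a.
  by apply: le_trans eb _; rewrite expr2 -mulrA ler_wpM2l.
have [->|bn0] := eqVneq b 0; first by rewrite mulr_ge0 // ltW.
have bp : 0 < b by rewrite lt_def bn0.
rewrite -(ler_pM2l bp) -expr2; apply: le_trans h _.
by rewrite mulrA (mulrC b) ler_pM2r.
Qed.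

(** * Orthonormal eigenbases *)

Section Eigenbasis.
Variable v : 'I_n -> 'cV[R]_n.
Hypothesis v_orth : forall i j, adot A (v i) (v j) = (i == j)%:R.

(** Orthonormality says [V^T A V = 1] for the matrix [V] of the [v i]; a
    one-sided inverse of a square matrix is two-sided, so [V V^T A = 1]. *)
Lemma orthonormal_expansion w : w = \sum_i adot A (v i) w *: v i.
Proof.
pose V := \matrix_(i, j) v j i 0.
have colV j : col j V = v j.
  by apply/matrixP => i k; rewrite !mxE (ord1 k).
have dotV i x : (V^T *m A *m x) i 0 = adot A (v i) x.
  have -> : (V^T *m A *m x) i 0 = row i (V^T *m A *m x) 0 0.
    by rewrite [RHS]mxE.
  by rewrite /adot -colV !row_mul tr_col.
have VV : V^T *m A *m V = 1%:M.
  by apply/matrixP => i j; rewrite [RHS]mxE -v_orth -dotV -colV colE mulmxA -colE [RHS]mxE.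
move/mulmx1C: VV => VV; rewrite -{1}[w]mul1mx -VV -mulmxA.
apply/matrixP => k l; rewrite (ord1 l) mxE summxE; apply: eq_bigr => i _.
by rewrite dotV !mxE mulrC.
Qed.

Lemma adot_eigen K (mu : 'I_n -> R) w :
  (forall i, K *m v i = mu i *: v i) ->
  adot A w (K *m w) = \sum_i mu i * adot A (v i) w ^+ 2.
Proof.
move=> eig; rewrite {2}(orthonormal_expansion w) mulmx_sumr /adot mulmx_sumr.
rewrite summxE; apply: eq_bigr => i _.
rewrite -scalemxAr eig -!/(adot _ _ _) !adotZr (adotC w); ring.
Qed.

Lemma Parseval w : adot A w w = \sum_i adot A (v i) w ^+ 2.
Proof.
rewrite -{2}[w]mul1mx (adot_eigen (K := 1%:M) (mu := fun=> 1)); last first.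
  by move=> i; rewrite mul1mx scale1r.
by apply: eq_bigr => i _; rewrite mul1r.
Qed.

End Eigenbasis.
End InnerProduct.

(** * Linear algebra of the two-level method *)

Lemma exists_ker (F : fieldType) m n (B : 'M[F]_(m, n)) : (m < n)%N ->
  exists2 d : 'cV[F]_n, d != 0 & B *m d = 0.
Proof.
move=> mn; have : kermx B^T != 0.
  rewrite kermx_eq0 -row_leq_rank -ltnNge.
  exact: leq_ltn_trans (rank_leq_col _) mn.
case/rowV0Pn => x /sub_kermxP xB x0; exists x^T.
  by rewrite -(inj_eq trmx_inj) trmxK trmx0.
by apply: trmx_inj; rewrite trmx_mul trmxK xB trmx0.
Qed.

Lemma posdef_unitmx (R : realType) n (B : 'M[R]_n) : posdef B -> B \in unitmx.
Proof.
move=> pB; rewrite -unitmx_tr -row_free_unit -kermx_eq0.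
apply: contraT => /rowV0Pn[x /sub_kermxP xB x0].
have xT0 : x^T != 0 by rewrite -(inj_eq trmx_inj) trmxK trmx0.
have := pB _ xT0; rewrite trmxK -mulmxA.
have -> : B *m x^T = 0 by apply: trmx_inj; rewrite trmx_mul trmxK xB trmx0.
by rewrite mulmx0 mxE ltxx.
Qed.

Lemma colspaceP (R : realType) m n (B : 'M[R]_(m, n)) (u : 'cV[R]_m) :
  u \in colspace B -> exists z, u = B *m z.
Proof.
rewrite /colspace => uB; pose X := [tuple of [seq col j B | j : 'I_n]].
have uX : u \in <<X>>%VS by [].
rewrite (coord_span uX).
have ex (i : 'I_#|'I_n|) : exists z, X`_i = B *m z.
  have /mapP[j _ ->] : X`_i \in [seq col j B | j : 'I_n].
    by apply: mem_nth; rewrite (size_tuple X).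
  by exists (delta_mx j 0); rewrite colE.
have [z zE] := choice ex.
exists (\sum_i coord X i u *: z i).
by rewrite mulmx_sumr; apply: eq_bigr => i _; rewrite -scalemxAr zE.
Qed.

Section TwoLevel.
Variables (R : realType) (n ns nc : nat).
Variables (A : 'M[R]_n) (S : 'M[R]_(n, ns)) (P : 'M[R]_(n, nc)) (M : 'M[R]_ns).
Hypothesis Aspd : spd A.

Lemma coarse_unitmx : \rank P = nc -> P^T *m A *m P \in unitmx.
Proof.
move=> rkP; apply: posdef_unitmx => y y0.
have Py0 : P *m y != 0.
  apply: contra_neq y0 => Py0; apply: trmx_inj.
  have fP : row_free P^T by rewrite /row_free mxrank_tr rkP.
  by apply: (row_free_inj fP); rewrite -trmx_mul Py0 trmx0 linear0 mul0mx.
by have := Aspd.2 _ Py0; rewrite trmx_mul !mulmxA.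
Qed.

Lemma PiA_selfadjoint : (PiA A P)^T *m A = A *m PiA A P.
Proof.
by rewrite /PiA !trmx_mul trmx_inv !trmx_mul !trmxK Aspd.1 !mulmxA.
Qed.

Lemma PiA_idem : \rank P = nc -> PiA A P *m PiA A P = PiA A P.
Proof.
move=> /coarse_unitmx uP; rewrite /PiA; set W := P^T *m A *m P.
transitivity (P *m (invmx W *m W) *m invmx W *m P^T *m A).
  by rewrite /W !mulmxA.
by rewrite mulVmx // mulmx1.
Qed.

Lemma coarse_complement : \rank P = nc -> P^T *m A *m (1%:M - PiA A P) = 0.
Proof.
move=> /coarse_unitmx uP.
rewrite mulmxBr mulmx1 /PiA !mulmxA mulmxV // mul1mx.
by rewrite subrr.
Qed.

Lemma PiA_vanish (w : 'cV[R]_n) : P^T *m (A *m w) = 0 -> (1%:M - PiA A P) *m w = w.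
Proof.
move=> Pw; rewrite mulmxBl mul1mx /PiA -!mulmxA Pw.
by rewrite !mulmx0 subr0.
Qed.

Lemma smoother_adjoint (X : 'M[R]_ns) :
  (1%:M - S *m X^T *m S^T *m A)^T *m A = A *m (1%:M - S *m X *m S^T *m A).
Proof.
rewrite linearB /= trmx1 !trmx_mul !trmxK Aspd.1 mulmxBl mulmxBr mul1mx mulmx1.
by rewrite !mulmxA.
Qed.

(** With [X = M + M^T - S^T A S], the inverse of [M^T X^-1 M] is [M^-1 X M^-T],
    which expands to [M^-1 + M^-T - M^-1 (S^T A S) M^-T]: exactly the terms
    produced by multiplying out the left-hand side. *)
Lemma symmetrized_smoother : M \in unitmx -> posdef (M + M^T - S^T *m A *m S) ->
  (1%:M - S *m invmx M *m S^T *m A) *m (1%:M - S *m invmx M^T *m S^T *m A)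
  = 1%:M - S *m invmx (smoother_tilde A S M) *m S^T *m A.
Proof.
move=> uM /posdef_unitmx uX.
have uMT : M^T \in unitmx by rewrite unitmx_tr.
have tildeV : invmx (smoother_tilde A S M)
    = invmx M + invmx M^T - invmx M *m (S^T *m A *m S) *m invmx M^T.
  have -> : invmx M + invmx M^T - invmx M *m (S^T *m A *m S) *m invmx M^T
      = invmx M *m (M + M^T - S^T *m A *m S) *m invmx M^T.
    rewrite mulmxBr mulmxDr mulVmx // mulmxBl mulmxDl mul1mx.
    by rewrite mulmxK // addrC (addrC (invmx M)) addrC.
  rewrite /smoother_tilde; set X := M + M^T - _ in uX *.
  have uT : M^T *m invmx X *m M \in unitmx.
    by rewrite !unitmx_mul uMT unitmx_inv uX uM.
  apply: (can_inj (mulKmx uT)); rewrite mulmxV //.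
  rewrite !mulmxA -(mulmxA _ M) mulmxV // mulmx1 -(mulmxA _ _ X) mulVmx //.
  by rewrite mulmx1 mulmxV.
rewrite tildeV mulmxBr mulmx1 mulmxBl mul1mx.
rewrite !(mulmxBl, mulmxDl, mulmxBr, mulmxDr) !mulmxA.
by rewrite !opprD !opprK !addrA; congr (_ + _); rewrite -!addrA.
Qed.

(** Inserting [Q = Q Q] in the middle. *)
Lemma ETL_factor : \rank P = nc ->
  ETL A S M P = (1%:M - S *m invmx M^T *m S^T *m A) *m (1%:M - PiA A P)
    *m ((1%:M - PiA A P) *m (1%:M - S *m invmx M *m S^T *m A)).
Proof.
move=> rkP; rewrite /ETL; set Q := 1%:M - PiA A P.
have QQ : Q *m Q = Q.
  by rewrite mulmxBr mulmx1 mulmxBl mul1mx PiA_idem // subrr subr0.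
by rewrite [RHS]mulmxA -(mulmxA _ Q Q) QQ.
Qed.

Lemma ETL_factor_adjoint :
  ((1%:M - S *m invmx M^T *m S^T *m A) *m (1%:M - PiA A P))^T *m A
  = A *m ((1%:M - PiA A P) *m (1%:M - S *m invmx M *m S^T *m A)).
Proof.
have adjG := smoother_adjoint (invmx M); rewrite trmx_inv in adjG.
have adjQ : (1%:M - PiA A P)^T *m A = A *m (1%:M - PiA A P).
  by rewrite linearB /= trmx1 mulmxBl mulmxBr PiA_selfadjoint mul1mx mulmx1.
by rewrite trmx_mul -[LHS]mulmxA adjG !mulmxA adjQ.
Qed.

End TwoLevel.

(** * The convergence factor *)

Theorem theorem3p8 (R : realType) (n ns nc : nat)
    (A : 'M[R]_n) (S : 'M[R]_(n, ns)) (P : 'M[R]_(n, nc)) (Ms : 'M[R]_ns)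
    (mu : 'I_n -> R) (v : 'I_n -> 'cV[R]_n)
    (Aspd : spd A)
    (le_ns : (ns <= n)%N) (lt_nc : (nc < n)%N)
    (rkS : \rank S = ns) (rkP : \rank P = nc)
    (rkSP : \rank (row_mx S P) = n)
    (S_id : forall e : ns = n, castmx (erefl n, e) S = 1%:M)
    (Ms_unit : Ms \in unitmx)
    (Ms_pd : posdef (Ms + Ms^T - S^T *m A *m S))
    (eig : forall i : 'I_n,
       S *m invmx (smoother_tilde A S Ms) *m S^T *m A *m v i = mu i *: v i)
    (mu_ge0 : forall i : 'I_n, 0 <= mu i)
    (mu_le1 : forall i : 'I_n, mu i <= 1)
    (mu_le : forall i j : 'I_n, (i <= j)%N -> mu i <= mu j)
    (v_orth : forall i j : 'I_n, ((v i)^T *m A *m v j) 0 0 = (i == j)%:R) :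
  Aopnorm A (ETL A S Ms P) >= 1 - mu (Ordinal lt_nc) /\
  (colspace P = <<[seq v (widen_ord (ltnW lt_nc) i) | i : 'I_nc]>>%VS ->
   Aopnorm A (ETL A S Ms P) = 1 - mu (Ordinal lt_nc)).
Proof.
have n_gt0 : (0 < n)%N by exact: leq_ltn_trans lt_nc.
rewrite ETL_factor //.
have adjN := ETL_factor_adjoint S P Ms Aspd.
set G' := 1%:M - S *m invmx Ms^T *m S^T *m A in adjN *.
set G := 1%:M - S *m invmx Ms *m S^T *m A in adjN *.
set Q := 1%:M - PiA A P in adjN *.
set t := 1 - mu _.
have t_ge0 : 0 <= t by rewrite subr_ge0.
have G'_form w : adot A (G' *m w) (G' *m w)
    = \sum_i (1 - mu i) * adot A (v i) w ^+ 2.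
  have adjG : G'^T *m A = A *m G by rewrite /G' -trmx_inv smoother_adjoint.
  rewrite (adot_adjoint _ _ adjG) mulmxA symmetrized_smoother //.
  apply: adot_eigen => // i.
  by rewrite mulmxBl mul1mx eig scalerBl scale1r.
have lower : t <= Aopnorm A (G' *m Q *m (Q *m G)).
  (* [nc] linear conditions on combinations of [nc + 1] eigenvectors. *)
  pose f (j : 'I_nc.+1) : 'I_n := widen_ord lt_nc j.
  pose V := \matrix_(i, j) v (f j) i 0.
  have [d d0 PVd] := exists_ker (P^T *m A *m V) (ltnSn nc).
  pose w := V *m d.
  have wE : w = \sum_j d j 0 *: v (f j).
    apply/matrixP => i k; rewrite (ord1 k) mxE summxE.
    by apply: eq_bigr => j _; rewrite !mxE mulrC.
  have coef i : adot A (v i) w = \sum_j d j 0 * (i == f j)%:R.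
    rewrite wE /adot mulmx_sumr summxE; apply: eq_bigr => j _.
    by rewrite -scalemxAr mxE v_orth.
  have coef_f j : adot A (v (f j)) w = d j 0.
    rewrite coef (bigD1 j) //= eqxx mulr1 big1 ?addr0 // => k kj.
    by rewrite -val_eqE /= val_eqE eq_sym (negbTE kj) mulr0.
  have w0 : w != 0.
    apply: contra_neq d0 => w0; apply/matrixP => j k.
    by rewrite (ord1 k) -coef_f w0 /adot mulmx0 !mxE.
  apply: (le_Aopnorm_adjoint Aspd adjN t_ge0 w0).
  have Qw : Q *m w = w by apply: PiA_vanish; rewrite /w !mulmxA.
  rewrite -mulmxA Qw G'_form (Parseval Aspd v_orth) mulr_sumr.
  apply: ler_sum => i _; have [le_i|gt_i] := leqP i nc.
    by rewrite ler_wpM2r ?sqr_ge0 // lerB // mu_le.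
  rewrite coef big1 ?expr0n ?mulr0 // => j _.
  rewrite -val_eqE /= gtn_eqF ?mulr0 //.
  by apply: leq_ltn_trans gt_i; rewrite -ltnS.
split=> // spanP; apply/eqP; rewrite eq_le lower andbT.
apply: (Aopnorm_adjoint_le Aspd n_gt0 adjN t_ge0) => y.
(* As R(P) is spanned by the first eigenvectors, [Q y] is [A]-orthogonal to
   them. *)
set w := Q *m y; have PTw : P^T *m (A *m w) = 0.
  by rewrite /w !mulmxA coarse_complement // mul0mx.
have vw (i : 'I_n) : (i < nc)%N -> adot A (v i) w = 0.
  move=> lt_i; have /colspaceP[z ->] : v i \in colspace P.
    rewrite spanP; apply: memv_span; apply/mapP; exists (Ordinal lt_i); rewrite ?mem_enum //.
    by congr v; apply: val_inj.
  by rewrite /adot trmx_mul -!mulmxA PTw mulmx0 mxE.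
(* [Q] is an [A]-orthogonal projection, hence a contraction. *)
have wy : adot A w w <= adot A y y.
  have split_y : y = w + PiA A P *m y by rewrite /w mulmxBl mul1mx subrK.
  have orth : adot A w (PiA A P *m y) = 0.
    rewrite -(adot_adjoint _ _ (PiA_selfadjoint P Aspd)).
    have -> : PiA A P *m w = 0.
      by rewrite /PiA -!mulmxA PTw !mulmx0.
    by rewrite /adot trmx0 !mul0mx mxE.
  rewrite {1 2}split_y !(adotDl, adotDr) (adotC Aspd _ w) orth.
  by rewrite addr0 add0r lerDl adot_ge0.
apply: le_trans (ler_wpM2l t_ge0 wy).
rewrite -mulmxA G'_form (Parseval Aspd v_orth) mulr_sumr.
apply: ler_sum => i _; have [lt_i|ge_i] := ltnP i nc.
  by rewrite vw // expr0n !mulr0.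
by rewrite ler_wpM2r ?sqr_ge0 // lerB // mu_le.
Qed.
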